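(* Suppose that $D$ is an ultrafilter over a set $I$, and $E$ is an ultrafilter over a set $J$. Then the following are equivalent. (1) $E \leq_{C} D$, that is, every $D$-compact topological space is $E$-compact. (2) Every $D$-closed class of models is $E$-closed. (3) For every model $\mathfrak{A}$, the smallest $D$-closed class containing $\mathfrak{A}$ is $E$-closed. (4) For every model $\mathfrak{A}$ with $|A| = \sup\{|I|,|J|\}$ (where $A$ is the universe of $\mathfrak{A}$), the smallest $D$-closed class containing $\mathfrak{A}$ is $E$-closed.
   Context: Models are first-order structures, of an arbitrary type (first-order language of arbitrary cardinality). If $D$ is an ultrafilter over $I$, a topological space $X$ is $D$-compact if for every $I$-indexed family $(x_i)_{i\in I}$ of points of $X$ there is a point $x\in X$ such that $\{i\in I : x_i\in U\}\in D$ for every neighborhood $U$ of $x$. The Comfort (pre-)order is defined by: $E\leq_C D$ if and only if every $D$-compact topological space is $E$-compact. No separation axiom is assumed on spaces. If $D$ is an ultrafilter over $I$, a class $K$ of models of the same type is $D$-closed if $K$ is closed under isomorphism, $K$ is closed under elementary substructures, and every ultraproduct $\prod_D \mathfrak{A}_i$ of an $I$-indexed family of members $\mathfrak{A}_i$ of $K$ belongs to $K$. *)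

(* Defs.v *)
From mathcomp Require Import all_boot.
From mathcomp Require Import boolp classical_sets functions cardinality.
From mathcomp Require Import filter topology.

Set Implicit Arguments.
Unset Strict Implicit.
Unset Printing Implicit Defensive.

Local Open Scope classical_set_scope.

Record language := Language {
  func : Type;
  frel : Type;
  func_arity : func -> nat;
  frel_arity : frel -> nat
}.

Record structure (L : language) := Structure {
  carrier :> Type;
  carrier_inhabited : inhabited carrier;
  func_interp : forall f : func L, ('I_(func_arity f) -> carrier) -> carrier;
  frel_interp : forall r : frel L, ('I_(frel_arity r) -> carrier) -> Prop
}.
Arguments func_interp {L} s f _.
Arguments frel_interp {L} s r _.

(* First-order formulas with equality and variables indexed by [nat]; the
    remaining connectives and the existential quantifier are definable, since
    the ambient logic is classical. *)
Inductive term (L : language) : Type :=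
| Var of nat
| App (f : func L) of ('I_(func_arity f) -> term L).

Inductive formula (L : language) : Type :=
| Falsum
| Equal of term L & term L
| Atom (r : frel L) of ('I_(frel_arity r) -> term L)
| Implies of formula L & formula L
| Forall of nat & formula L.

Fixpoint eval L (M : structure L) (v : nat -> M) (t : term L) : M :=
  match t with
  | Var x => v x
  | App f ts => func_interp M f (fun k => eval v (ts k))
  end.

Definition update (T : Type) (v : nat -> T) (x : nat) (a : T) : nat -> T :=
  fun y => if y == x then a else v y.

Fixpoint sat L (M : structure L) (v : nat -> M) (p : formula L) : Prop :=
  match p with
  | Falsum => False
  | Equal s t => eval v s = eval v t
  | Atom r ts => frel_interp M r (fun k => eval v (ts k))
  | Implies p q => sat v p -> sat v q
  | Forall x p => forall a : M, sat (update v x a) p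
  end.

Definition isomorphic L (M N : structure L) : Prop :=
  exists h : M -> N,
    [/\ bijective h,
        forall f xs, h (func_interp M f xs) = func_interp N f (h \o xs) &
        forall r xs, frel_interp M r xs <-> frel_interp N r (h \o xs)].

Definition func_closed L (M : structure L) (S : set M) : Prop :=
  forall f xs, (forall k, S (xs k)) -> S (func_interp M f xs).

Definition substructure L (M : structure L) (S : set M)
    (S0 : S !=set0) (Sf : func_closed S) : structure L :=
  @Structure L {x : M | S x}
    (let: ex_intro x Sx := S0 in inhabits (exist _ x Sx))
    (fun f xs => exist _ (func_interp M f (fun k => sval (xs k)))
                         (Sf f _ (fun k => svalP (xs k))))
    (fun r xs => frel_interp M r (fun k => sval (xs k))).

Definition elementary L (M : structure L) (S : set M)
    (S0 : S !=set0) (Sf : func_closed S) : Prop :=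
  forall (p : formula L) (v : nat -> substructure S0 Sf),
    sat v p <-> @sat L M (fun n => sval (v n)) p.

Section ultraproduct.
Variables (L : language) (I : Type) (D : set_system I) (M : I -> structure L).

Definition ultra_eq (x y : forall i, M i) : Prop :=
  \forall i \near D, x i = y i.

(* Written with [_ -> Prop] rather than [set _]: this type is itself a
    carrier, and the universe of [set] must stay above that of [structure]. *)
Definition ultra_carrier : Type :=
  {c : (forall i, M i) -> Prop | exists x, c = ultra_eq x}.

Definition ultra_class (x : forall i, M i) : ultra_carrier :=
  exist _ (ultra_eq x) (ex_intro _ x erefl).

Definition ultra_repr (c : ultra_carrier) : forall i, M i :=
  projT1 (cid (svalP c)).

Lemma ultra_carrier_inhabited : inhabited ultra_carrier.
Proof.
have x i : M i by have [x _] := cid (let: inhabits x := carrier_inhabited (M i)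
  in ex_intro (fun=> True) x Logic.I).
exact: inhabits (ultra_class x).
Qed.

(* The operations are computed on chosen representatives; [ultra_funcE] and
    [ultra_frelE] below show that the choice is immaterial. *)
Definition ultraproduct : structure L :=
  @Structure L ultra_carrier ultra_carrier_inhabited
    (fun f cs =>
       ultra_class (fun i => func_interp (M i) f (fun k => ultra_repr (cs k) i)))
    (fun r cs =>
       \forall i \near D, frel_interp (M i) r (fun k => ultra_repr (cs k) i)).

Hypothesis FD : Filter D.

Lemma ultra_classP (x y : forall i, M i) :
  ultra_class x = ultra_class y <-> ultra_eq x y.
Proof.
rewrite /ultra_class; split=> [/(congr1 sval)/= /(congr1 (@^~ y)) ->|xy].
  by apply: filterE.
apply: eq_exist; apply/funext => z; apply/propext; split => h.
  by apply: filterS2 xy h => i ->.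
by apply: filterS2 xy h => i ->.
Qed.

Lemma ultra_reprK (c : ultra_carrier) : ultra_class (ultra_repr c) = c.
Proof.
rewrite /ultra_repr; case: c => c cx; rewrite /ultra_class; apply: eq_exist.
by case: cid => x /= ->.
Qed.

Lemma ultra_repr_near n (xs : 'I_n -> forall i, M i) :
  \forall i \near D,
    (fun k => ultra_repr (ultra_class (xs k)) i) = (fun k => xs k i).
Proof.
suff: \forall i \near D, forall k, ultra_repr (ultra_class (xs k)) i = xs k i.
  by apply: filterS => i h; apply/funext.
by apply: filter_forall => k; apply/ultra_classP; rewrite ultra_reprK.
Qed.

Lemma ultra_funcE (f : func L) (xs : 'I_(func_arity f) -> forall i, M i) :
  func_interp ultraproduct f (fun k => ultra_class (xs k)) =
  ultra_class (fun i => func_interp (M i) f (fun k => xs k i)).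
Proof.
apply/ultra_classP; apply: filterS (ultra_repr_near xs) => i.
by move=> /= ->.
Qed.

Lemma ultra_frelE (r : frel L) (xs : 'I_(frel_arity r) -> forall i, M i) :
  frel_interp ultraproduct r (fun k => ultra_class (xs k)) <->
  \forall i \near D, frel_interp (M i) r (fun k => xs k i).
Proof.
by split => h; apply: filterS2 h (ultra_repr_near xs) => i /= h e;
  rewrite ?e // -e.
Qed.

End ultraproduct.

Record ultra_closed (I : Type) (D : set_system I) L (K : set (structure L)) :
    Prop := UltraClosed {
  closed_iso : forall M N, isomorphic M N -> K M -> K N;
  closed_elementary : forall (M : structure L) (S : set M)
      (S0 : S !=set0) (Sf : func_closed S),
    elementary S0 Sf -> K M -> K (substructure S0 Sf);
  closed_ultraproduct : forall M : I -> structure L,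
    (forall i, K (M i)) -> K (ultraproduct D M)
}.

Definition generated_class (I : Type) (D : set_system I) L (A : structure L) :
    set (structure L) :=
  smallest (@ultra_closed I D L) [set A].

Lemma generated_class_closed (I : Type) (D : set_system I) L (A : structure L) :
  ultra_closed D (generated_class D A).
Proof.
split=> [M N MN KM K HK|M S S0 Sf el KM K HK|M KM K HK].
- exact: (closed_iso HK.1 MN (KM K HK)).
- exact: (closed_elementary HK.1 el (KM K HK)).
- by apply: (closed_ultraproduct HK.1) => i; exact: KM.
Qed.

Definition ultra_compact (I : Type) (D : set_system I) (X : topologicalType) :
    Prop :=
  forall x : I -> X, exists l : X, x @ D --> l.

Definition comfort_le (J I : Type) (E : set_system J) (D : set_system I) :
    Prop :=
  forall X : topologicalType, ultra_compact D X -> ultra_compact E X.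

Definition card_sup (I J A : Type) : Prop :=
  [/\ ([set: I] #<= [set: A])%card, ([set: J] #<= [set: A])%card &
      forall C : Type, ([set: I] #<= [set: C])%card ->
        ([set: J] #<= [set: C])%card -> ([set: A] #<= [set: C])%card].

(* Main.v *)
(** For a [D]-closed class [K] and structures [M_j] in [K], let [G] be the set of
    ultrafilters [F] over [J] such that the ultraproduct of the [M_j] over [F]
    is in [K].  A [D]-limit [F] of ultrafilters [F_i] in [G] is again in [G],
    because the ultraproduct over [F] embeds elementarily into the
    [D]-ultraproduct of the ultraproducts over the [F_i].  Hence [G], as a
    subspace of the Stone-Cech compactification of [J], is [D]-compact; if it is
    [E]-compact, then the [E]-limit of the principal ultrafilters, which is [E],
    belongs to it.

    Conversely, given points [x_a] of a [D]-compact space indexed by a set [A]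
    into which [J] embeds, let [A] carry all its unary predicates.  The
    structures all of whose elements [m] have a type [{B | B(m)}] along which
    [x] converges form a [D]-closed class containing [A]; if this class contains
    the [E]-power of [A], then [x] converges along the image of [E]. *)
Require Import Defs.
From HB Require Import structures.
From mathcomp Require Import all_boot.
From mathcomp Require Import boolp classical_sets functions cardinality.
From mathcomp Require Import filter topology.

Set Implicit Arguments.
Unset Strict Implicit.
Unset Printing Implicit Defensive.

Local Open Scope classical_set_scope.

(** * Ultrafilters and their limits *)

Lemma near_not (T : Type) (F : set_system T) (A : set T) :
  UltraFilter F -> F (~` A) <-> ~ F A.
Proof.
move=> FU; split=> [FnA FA|nFA]; last by case: (in_ultra_setVsetC A FU).
by have [x []] := filter_ex (filterI FA FnA).
Qed.

Lemma near_implies (T : Type) (F : set_system T) (P Q : set T) :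
  UltraFilter F ->
  (\forall x \near F, P x -> Q x) <->
  ((\forall x \near F, P x) -> \forall x \near F, Q x).
Proof.
move=> FU; split=> [FPQ FP|FPQ]; first by apply: filterS2 FPQ FP => x; exact.
have [/FPQ FQ|FnP] := in_ultra_setVsetC P FU; first by apply: filterS FQ.
by apply: filterS FnP.
Qed.

(** For ultrafilters [F i], this is their limit along [D] in the Stone-Cech compactification of
    [J]. *)
Definition limit_filter (I J : Type) (D : set_system I)
    (F : I -> set_system J) : set_system J :=
  fun A => \forall i \near D, F i A.

Lemma limit_filter_ultra (I J : Type) (D : set_system I)
    (F : I -> set_system J) :
  UltraFilter D -> (forall i, UltraFilter (F i)) ->
  UltraFilter (limit_filter D F).
Proof.
move=> DU FU; split.
  apply: Build_ProperFilter_ex.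
    by move=> A; rewrite /limit_filter => /filter_ex[i]; exact: filter_ex.
  split; rewrite /limit_filter.
  - by apply: filterE => i; exact: filterT.
  - by move=> A B; apply: filterS2 => i; exact: filterI.
  - by move=> A B AB; apply: filterS => i; exact: filterS.
move=> G GP FG; apply/seteqP; split=> // A GA; apply: contrapT => nFA.
(* Complements pass through [D] and through each [F i], so a set outside the limit has its
   complement in it. *)
have /FG GnA : limit_filter D F (~` A).
  have : D (~` [set i | F i A]) by apply/near_not.
  by apply: filterS => i /= ?; apply/near_not.
by have [x []] := filter_ex (filterI GA GnA).
Qed.

(** * The theorem of Los on ultraproducts *)

Section los.
Variables (L : language) (I : Type) (D : set_system I) (M : I -> structure L).
Hypothesis DU : UltraFilter D.

Lemma ultra_evalE (v : nat -> forall i, M i) (t : term L) :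
  @Defs.eval L (ultraproduct D M) (fun n => ultra_class D (v n)) t =
  ultra_class D (fun i => Defs.eval (fun n => v n i) t).
Proof.
elim: t => // f ts IH; rewrite -[RHS]ultra_funcE.
by apply: (congr1 (func_interp _ f)); apply/funext.
Qed.

Lemma update_ultra_class (v : nat -> forall i, M i) n (a : forall i, M i) :
  update (fun m => ultra_class D (v m)) n (ultra_class D a) =
  fun m => ultra_class D (fun i => update (fun m => v m i) n (a i) m).
Proof. by apply/funext => m; rewrite /update; case: eqP. Qed.

Theorem los (p : formula L) (v : nat -> forall i, M i) :
  @sat L (ultraproduct D M) (fun n => ultra_class D (v n)) p <->
  \forall i \near D, sat (fun n => v n i) p.
Proof.
elim: p v => [|s t|r ts|p IHp q IHq|x p IHp] v /=.
- by split=> // /filter_ex[].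
- by rewrite !ultra_evalE ultra_classP.
- rewrite -(ultra_frelE _ (fun k i => Defs.eval (fun n => v n i) (ts k))).
  suff <- : (fun k => @Defs.eval L (ultraproduct D M)
                        (fun n => ultra_class D (v n)) (ts k)) =
            fun k => ultra_class D (fun i => Defs.eval (fun n => v n i) (ts k)).
    by [].
  by apply/funext => k; exact: ultra_evalE.
- by rewrite IHp IHq near_implies.
- split=> [all_p|near_p a].
    apply: contrapT => /(near_not _ DU).2 near_np.
    (* In each factor a counterexample to [p] is chosen if there is one, and any element otherwise;
       the instance of [all_p] at the class of these choices contradicts [near_np]. *)
    have witness i : exists a : M i,
        ~ (forall b, sat (update (fun m => v m i) x b) p) ->
        ~ sat (update (fun m => v m i) x a) p.
      have [b] := carrier_inhabited (M i).
      have [h|/existsNP[a na]] :=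
        pselect (forall b, sat (update (fun m => v m i) x b) p).
        by exists b => /(_ h).
      by exists a.
    pose a i := sval (cid (witness i)).
    have := all_p (ultra_class D a); rewrite update_ultra_class IHp => near_a.
    by have [i [/(svalP (cid (witness i)))]] :=
      filter_ex (filterI near_np near_a).
  rewrite -(ultra_reprK a) update_ultra_class IHp.
  by apply: filterS near_p => i; exact.
Qed.

End los.

(** * Elementary embeddings *)

Lemma valuation_of_tuple (T : Type) n (xs : 'I_n -> T) :
  inhabited T -> exists v : nat -> T, forall k : 'I_n, v k = xs k.
Proof.
(* Indices from [n] on receive the default value [x0]. *)
move=> [x0]; exists (fun m => oapp xs x0 (insub m)) => k.
by rewrite valK.
Qed.

Definition elementary_embedding L (M N : structure L) (h : M -> N) : Prop :=
  forall (p : formula L) (v : nat -> M), sat v p <-> sat (h \o v) p.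

Section elementary_embedding.
Variables (L : language) (M N : structure L) (h : M -> N).
Hypothesis hE : elementary_embedding h.

Lemma embedding_inj : injective h.
Proof.
move=> x y hxy.
pose v n := if n is 0 then x else y.
by have /= := hE (Equal (Var L 0) (Var L 1)) v; rewrite hxy => -[_]; apply.
Qed.

Lemma embedding_func f xs :
  h (func_interp M f xs) = func_interp N f (h \o xs).
Proof.
have [v vE] := valuation_of_tuple xs (carrier_inhabited M).
pose n := func_arity f.
(* The variables below [n] hold the arguments, so [n] is the first one free to hold the value; the
   formula tested defines the graph of [f]. *)
pose w m := if m == n then func_interp M f xs else v m.
have wE (k : 'I_n) : w k = xs k.
  by rewrite /w (ltn_eqF (ltn_ord k)) vE.
have [/= + _] := hE (Equal (Var L n) (App (fun k : 'I_n => Var L k))) w.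
rewrite {1 3}/w eqxx; under eq_fun do rewrite wE.
rewrite [fun k : 'I_n => h (w k)](_ : _ = h \o xs); first exact.
by apply/funext => k; rewrite wE.
Qed.

Lemma embedding_rel r xs : frel_interp M r xs <-> frel_interp N r (h \o xs).
Proof.
have [v vE] := valuation_of_tuple xs (carrier_inhabited M).
have /= := hE (Atom (fun k : 'I_(frel_arity r) => Var L k)) v.
have -> : (fun k : 'I_(frel_arity r) => v k) = xs by apply/funext.
suff -> : (fun k : 'I_(frel_arity r) => h (v k)) = h \o xs by [].
by apply/funext => k /=; rewrite vE.
Qed.

Lemma embedding_range0 : range h !=set0.
Proof. by have [x] := carrier_inhabited M; exists (h x), x. Qed.

Lemma embedding_range_closed : func_closed (range h).
Proof.
move=> f xs xsh; have /choice[ys ysE] : forall k, exists y, h y = xs k.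
  by move=> k; have [y _ yE] := xsh k; exists y.
exists (func_interp M f ys) => //.
rewrite embedding_func; apply: (congr1 (func_interp _ f)).
exact/funext.
Qed.

Let img := substructure embedding_range0 embedding_range_closed.

Lemma embedding_elementary :
  elementary embedding_range0 embedding_range_closed.
Proof.
(* Since [h] identifies [M] with its image, formulas have the same truth value in both; [hE] then
   compares [M] with [N]. *)
suff iso : forall (p : formula L) (w : nat -> M) (v : nat -> img),
    (forall n, sval (v n) = h (w n)) -> sat v p <-> sat w p.
  move=> p v.
  have /choice[w wE] : forall n, exists x, h x = sval (v n).
    by move=> n; have [x _ xE] := svalP (v n); exists x.
  rewrite (iso _ w) // hE.
  by suff -> : h \o w = fun n => sval (v n) by []; apply/funext.
have eval_img t (w : nat -> M) (v : nat -> img) :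
    (forall n, sval (v n) = h (w n)) ->
    sval (Defs.eval v t) = h (Defs.eval w t).
  move=> vw; elim: t => //= f ts IH.
  rewrite embedding_func; apply: (congr1 (func_interp _ f)).
  by apply/funext => k; exact: IH.
elim=> [|s t|r ts|p IHp q IHq|x p IHp] w v vw //=.
- split=> [/(congr1 sval)|st].
    by rewrite !(eval_img _ _ _ vw) => /embedding_inj.
  by apply: eq_sig_hprop => [? ? ?|]; rewrite ?(eval_img _ _ _ vw) ?st.
- rewrite embedding_rel.
  suff -> : (fun k => sval (Defs.eval v (ts k))) =
            h \o (fun k => Defs.eval w (ts k)) by [].
  by apply/funext => k; exact: eval_img.
- by rewrite (IHp _ _ vw) (IHq _ _ vw).
- split=> all_p.
    move=> a; pose b : img := exist _ (h a) (ex_intro2 _ _ a Logic.I erefl).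
    by apply/(IHp _ (update v x b)) => // n; rewrite /update; case: eqP.
  move=> b; have [a _ ab] := svalP b.
  by apply/(IHp (update w x a)) => // n; rewrite /update; case: eqP.
Qed.

Lemma embedding_isomorphic : isomorphic img M.
Proof.
have /choice[g gE] : forall b : img, exists x, h x = sval b.
  by move=> b; have [x _ xE] := svalP b; exists x.
exists g; split.
- exists (fun a => exist _ (h a) (ex_intro2 _ _ a Logic.I erefl)).
    by move=> b; apply: eq_sig_hprop => [? ? ?|] //=.
  by move=> a; apply: embedding_inj; rewrite gE.
- move=> f xs; apply: embedding_inj; rewrite gE embedding_func /=.
  by apply: (congr1 (func_interp _ f)); apply/funext => k /=; rewrite gE.
- move=> r xs; rewrite embedding_rel /=.
  suff -> : h \o (g \o xs) = fun k => sval (xs k) by [].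
  by apply/funext => k /=; rewrite gE.
Qed.

(** [M] is isomorphic to the image of [h], which is an elementary substructure of [N]. *)
Lemma closed_embedding (I : Type) (D : set_system I)
    (K : set (structure L)) : ultra_closed D K -> K N -> K M.
Proof.
move=> KD KN; apply: (closed_iso KD embedding_isomorphic).
exact: (closed_elementary KD embedding_elementary).
Qed.

End elementary_embedding.

(** * Ultraproducts over principal ultrafilters and over limits *)

Lemma ultraproduct_principal L (J : Type) (M : J -> structure L) (j : J) :
  @elementary_embedding L (ultraproduct (principal_filter j) M) (M j)
    (fun c => ultra_repr c j).
Proof.
move=> p v; have FU := principal_filter_ultra j.
have {1}-> : v = fun n => ultra_class _ (ultra_repr (v n)).
  by apply/funext => n; rewrite ultra_reprK.
rewrite los; exact: principal_filterP.
Qed.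

(** The embedding is diagonal: the class of a family goes to the sequence of its classes modulo the
    [F i]. By [los], truth on either side means truth in [M j] for [F i]-most [j], for [D]-most
    [i]. *)
Lemma ultraproduct_limit L (I J : Type) (D : set_system I)
    (F : I -> set_system J) (M : J -> structure L) :
  UltraFilter D -> (forall i, UltraFilter (F i)) ->
  @elementary_embedding L (ultraproduct (limit_filter D F) M)
    (ultraproduct D (fun i => ultraproduct (F i) M))
    (fun c => @ultra_class L I D (fun i => ultraproduct (F i) M)
                (fun i => ultra_class (F i) (ultra_repr c))).
Proof.
move=> DU FU p v; have LU := limit_filter_ultra DU FU.
have {1}-> : v = fun n => ultra_class _ (ultra_repr (v n)).
  by apply/funext => n; rewrite ultra_reprK.
rewrite /comp !los; split=> near_p.
  apply: (@filterS _ D _ _ _ _ near_p) => i; by rewrite los.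
apply: (@filterS _ D _ _ _ _ near_p) => i; by rewrite los.
Qed.

(** * The Stone topology on a set of ultrafilters *)

Definition ultrafilter_space (J : Type) (G : set_system J -> Prop) : Type :=
  {F : set_system J | UltraFilter F /\ G F}.

Section ultrafilter_space.
Variables (J : Type) (G : set_system J -> Prop).

Local Notation space := (ultrafilter_space G).

(** The basic open sets consist of the ultrafilters of the space that contain a given [A], as in the
    Stone-Cech compactification of [J]. *)
Definition ultrafilter_nbhs (x : space) : set_system space :=
  fun U => exists2 A, sval x A & forall y : space, sval y A -> U y.

Lemma ultrafilter_nbhs_filter (x : space) : ProperFilter (ultrafilter_nbhs x).
Proof.
have FU := (svalP x).1.
apply: Build_ProperFilter_ex; first by move=> U [A xA]; exists x; auto.
split.
- by exists setT => //; exact: filterT.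
- move=> U V [A xA AU] [B xB BV]; exists (A `&` B); first exact: filterI.
  move=> y yAB; have yU := (svalP y).1.
  by split; [apply: AU | apply: BV]; apply: filterS yAB => ? [].
- by move=> U V UV [A xA AU]; exists A => // y /AU/UV.
Qed.

Lemma ultrafilter_nbhs_singleton (x : space) (U : set space) :
  ultrafilter_nbhs x U -> U x.
Proof. by move=> [A xA]; exact. Qed.

Lemma ultrafilter_nbhs_nbhs (x : space) (U : set space) :
  ultrafilter_nbhs x U -> ultrafilter_nbhs x (ultrafilter_nbhs^~ U).
Proof. by move=> [A xA AU]; exists A => // y yA; exists A. Qed.

HB.instance Definition _ := gen_eqMixin space.
HB.instance Definition _ := gen_choiceMixin space.
HB.instance Definition _ := hasNbhs.Build space ultrafilter_nbhs.
HB.instance Definition _ := Nbhs_isNbhsTopological.Build space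
  ultrafilter_nbhs_filter ultrafilter_nbhs_singleton ultrafilter_nbhs_nbhs.

(** The limit point is [limit_filter]: it contains [A] exactly when [D]-most terms do, which is
    convergence on basic neighborhoods. *)
Lemma ultrafilter_space_compact (I : Type) (D : set_system I) :
  UltraFilter D ->
  (forall F : I -> set_system J, (forall i, UltraFilter (F i)) ->
    (forall i, G (F i)) -> G (limit_filter D F)) ->
  ultra_compact D space.
Proof.
move=> DU Glim x.
have xU i : UltraFilter (sval (x i)) := (svalP (x i)).1.
have limP : UltraFilter (limit_filter D (fun i => sval (x i))) /\
    G (limit_filter D (fun i => sval (x i))).
  split; first exact: limit_filter_ultra.
  by apply: Glim => // i; exact: (svalP (x i)).2.
exists (exist (fun F => UltraFilter F /\ G F) _ limP) => U [A /= xA AU].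
by apply: (@filterS _ D _ _ _ _ xA) => i; exact: AU.
Qed.

Lemma ultrafilter_space_lim (E : set_system J) :
  UltraFilter E -> (forall j, G (principal_filter j)) ->
  ultra_compact E space -> G E.
Proof.
move=> EU Gprincipal /(_ (fun j => exist _ (principal_filter j)
    (conj (principal_filter_ultra j) (Gprincipal j))))[[F [FU GF]] Flim].
have -> // : E = F.
(* As [F] is maximal, [F] included in [E] suffices. The indices whose principal ultrafilter contains
   [A] form [A] itself, so convergence to [F] puts [A] in [E]. *)
apply: max_filter => A FA.
suff /Flim : nbhs (exist _ F (conj FU GF) : space) [set y | sval y A].
  move=> EA; apply: (@filterS _ E _ _ _ _ EA) => j; exact.
by exists A.
Qed.

End ultrafilter_space.

Lemma comfort_le_closed (I J : Type) (D : set_system I) (E : set_system J)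
    (L : language) (K : set (structure L)) :
  UltraFilter D -> UltraFilter E ->
  comfort_le E D -> ultra_closed D K -> ultra_closed E K.
Proof.
move=> DU EU ED KD; split=> [M N|M S S0 Sf|M KM].
- exact: closed_iso KD _ _.
- exact: closed_elementary KD _ _ _ _.
pose G (F : set_system J) := K (ultraproduct F M).
apply: (@ultrafilter_space_lim _ G) => // [j|].
  exact: (closed_embedding (@ultraproduct_principal L J M j) KD (KM j)).
apply: (ED (ultrafilter_space G)); apply: ultrafilter_space_compact => F FU GF.
apply: (closed_embedding (ultraproduct_limit DU FU) KD).
by apply: (closed_ultraproduct KD) => i; exact: GF.
Qed.

(** * Convergence of types in structures with unary predicates *)

Definition unary_language (A : Type) : language :=
  @Language void (A -> Prop) (fun=> 0) (fun=> 1).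

Definition unary_structure (A : Type) (A0 : inhabited A) :
    structure (unary_language A) :=
  @Structure (unary_language A) A A0
    (fun f => match f with end) (fun B xs => B (xs ord0)).

Definition type_converges (A : Type) (X : topologicalType) (x : A -> X)
    (M : structure (unary_language A)) (m : M) (l : X) : Prop :=
  forall U, open U -> U l ->
    @frel_interp (unary_language A) M (x @^-1` U) (fun=> m).

(** For ultraproducts, a limit [y i] is chosen for the type of each coordinate, and [l] is a
    [D]-limit of the [y i]: an open [U] around [l] contains [D]-most [y i], so its preimage belongs
    to [D]-most of the types. *)
Lemma types_converge_closed (I A : Type) (D : set_system I)
    (X : topologicalType) (x : A -> X) :
  UltraFilter D -> ultra_compact D X ->
  ultra_closed D
    [set M : structure (unary_language A) |
      forall m : M, exists l, type_converges x m l].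
Proof.
move=> DU DX.
split=> [M N [h [[g hK gK] _ h_rel]] cvM n|M S S0 Sf _ cvM m|M cvM c].
- have [l lP] := cvM (g n); exists l => U oU Ul.
  have /h_rel := lP U oU Ul.
  by rewrite (_ : h \o _ = fun=> n) //; apply/funext => k /=; rewrite gK.
- by have [l lP] := cvM (sval m); exists l => U oU Ul; exact: lP.
have /choice[y yP] : forall i, exists l,
    type_converges x (ultra_repr c i) l by move=> i; exact: cvM.
have [l yl] := DX y; exists l => U oU Ul.
have : \forall i \near D, U (y i) by apply: yl; exact: open_nbhs_nbhs.
by apply: filterS => i Uy; exact: yP.
Qed.

Lemma generated_class_comfort_le (I J A : Type) (D : set_system I)
    (E : set_system J) (A0 : inhabited A) (f : J -> A) :
  UltraFilter D -> UltraFilter E -> injective f ->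
  ultra_closed E (generated_class D (unary_structure A0)) -> comfort_le E D.
Proof.
move=> DU EU f_inj EA X DX x.
have [j0 _] := filter_ex (filterT : E setT).
(* [y] transports [x] along [f]; outside the range of [f] it takes the arbitrary value [x j0]. *)
pose y a := if pselect (exists j, f j = a) is left fa then x (sval (cid fa))
            else x j0.
have yf j : y (f j) = x j.
  rewrite /y; case: pselect => [fj|]; last by case; exists j.
  by congr x; apply: f_inj; exact: svalP (cid fj).
pose A_E := ultraproduct E (fun=> unary_structure A0).
have A_E_generated : generated_class D (unary_structure A0) A_E.
  by apply: (closed_ultraproduct EA) => _ K [_]; exact.
have A_E_cv : forall m : A_E, exists l, type_converges y m l.
  apply: (A_E_generated _ (conj (types_converge_closed y DU DX) _)).
  (* In [A] itself the type of [a] is principal, hence converges to [y a]. *)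
  by move=> _ -> a; exists (y a).
(* The type of the class of [f] is the image of [E] under [f], so a limit of [y] along it is a limit
   of [x] along [E]. *)
have [l lP] := A_E_cv (@ultra_class _ J E (fun=> unary_structure A0) f).
exists l => V; rewrite nbhsE => -[U [oU Ul] UV].
have /(@ultra_frelE _ _ E (fun=> unary_structure A0)) := lP U oU Ul.
by apply: filterS => j; rewrite /= yf => /UV.
Qed.

(** * Comparability of cardinals *)

Lemma injective_card_le (A B : Type) (f : A -> B) :
  injective f -> ([set: A] #<= [set: B])%card.
Proof.
move=> f_inj; have fT : {in [set: A] &, injective f} by move=> ? ? _ _ /f_inj.
by rewrite -(card_le_eql (inj_card_eq fT)); exact: subset_card_le.
Qed.

Lemma card_le_injective (A B : Type) :
  ([set: A] #<= [set: B])%card -> exists f : A -> B, injective f.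
Proof.
move=> /card_leP[f].
exists (fun a => val (f (SigSub (mem_set (Logic.I : [set: A] a))))).
by move=> a b /val_inj /inj -/(_ (mem_set Logic.I) (mem_set Logic.I)) [].
Qed.

(** Zorn's lemma gives a maximal partial bijection; it is total on one side, since otherwise a pair
    of unmatched points could be added to it. *)
Lemma card_le_total (A B : Type) :
  ([set: A] #<= [set: B])%card \/ ([set: B] #<= [set: A])%card.
Proof.
pose partial_bij (R : set (A * B)) :=
  forall x y, R x -> R y -> x.1 = y.1 <-> x.2 = y.2.
have [F F_tot|R [R_bij R_max]] := @Zorn_bigcup _ partial_bij.
  move=> F_chain x y [X FX Xx] [Y FY Yy].
  have [XY|YX] := F_chain _ _ FX FY.
    by apply: (F_tot _ FY) => //; exact: XY.
  by apply: (F_tot _ FX) => //; exact: YX.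
have [/choice[f fR]|/existsNP[a aR]] := pselect (forall a, exists b, R (a, b)).
  left; apply: (@injective_card_le _ _ f) => a a' faa'.
  by apply/(R_bij _ _ (fR a) (fR a')).
have [/choice[g gR]|/existsNP[b bR]] := pselect (forall b, exists a, R (a, b)).
  right; apply: (@injective_card_le _ _ g) => b b' gbb'.
  by apply/(R_bij _ _ (gR b) (gR b')).
exfalso; apply: (R_max (R `|` [set (a, b)])).
  split=> [|RabR]; first exact: subsetUl.
  by apply: aR; exists b; apply: RabR; right.
move=> [a1 b1] [a2 b2] [R1|[-> ->]] [R2|[-> ->]] //=; first exact: R_bij R1 R2.
- by split=> ab; [case: aR; exists b1|case: bR; exists a1]; rewrite -ab.
- by split=> ab; [case: aR; exists b2|case: bR; exists a2]; rewrite ab.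
Qed.

Lemma card_sup_max (I J : Type) : card_sup I J I \/ card_sup I J J.
Proof.
by have [IJ|JI] := card_le_total I J; [right|left]; split.
Qed.

Theorem proposition5 (I J : Type) (D : set_system I) (E : set_system J)
    (hD : UltraFilter D) (hE : UltraFilter E) :
  [<-> comfort_le E D;
       forall (L : language) (K : set (structure L)),
         ultra_closed D K -> ultra_closed E K;
       forall (L : language) (A : structure L),
         ultra_closed E (generated_class D A);
       forall (L : language) (A : structure L),
         card_sup I J A -> ultra_closed E (generated_class D A)].
Proof.
tfae=> [ED L K|DE L A|closed L A _|closed].
- exact: comfort_le_closed.
- exact/DE/generated_class_closed.
- exact: closed.
(* By comparability the supremum is attained by [I] or by [J], so one of them can serve as the
   universe [A]; both are inhabited because [D] and [E] are proper. *)
suff comfort (A : Type) (A0 : inhabited A) : card_sup I J A -> comfort_le E D.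
  have [i0 _] := filter_ex (filterT : D setT).
  have [j0 _] := filter_ex (filterT : E setT).
  by have [] := card_sup_max I J; apply: comfort; apply: inhabits.
move=> A_sup; have [_ /card_le_injective[f f_inj] _] := A_sup.
apply: (generated_class_comfort_le (A0 := A0) hD hE f_inj).
exact: closed.
Qed.
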